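(* Let $H$ be a finitely generated normal subgroup of a finitely generated group $\Gamma$, and let $\alpha:\Gamma\to\Gamma$ be a group endomorphism such that $\alpha(H)\subset H$. Then $$GR(\alpha)\le\max\{GR(\alpha\text{ on }H),\ GR(\alpha\text{ on }\Gamma/H)\}.$$
   Context: For a group $G$ with finite generating set $T$ and $g\in G$, $|g|_T$ denotes the length of the shortest word in the letters $T\cup T^{-1}$ representing $g$. The growth rate of an endomorphism $\beta:G\to G$ is $GR(\beta)=\sup_{g\in G}\ \limsup_{m\to\infty}\sqrt[m]{|\beta^m(g)|_T}$. $GR(\alpha\text{ on }H)$ is the growth rate of the restriction $\alpha|_H:H\to H$ (word length with respect to a finite generating set of $H$), and $GR(\alpha\text{ on }\Gamma/H)$ is the growth rate of the endomorphism of $\Gamma/H$ induced by $\alpha$. *)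

(* Defs.v *)
From HB Require Import structures.
From mathcomp Require Import all_boot all_order all_algebra.
From mathcomp Require Import all_classical all_reals all_analysis.

Set Implicit Arguments.
Unset Strict Implicit.
Unset Printing Implicit Defensive.

Import Order.TTheory GRing.Theory Num.Theory.

Local Open Scope group_scope.
Local Open Scope quotient_scope.

(* A subgroup of a (possibly infinite) group G is a [groupClosed G]; since     *)
(* membership is classically decidable, every subset of G is a {pred G}.      *)
HB.mixin Record isConjClosed (G : groupType) (S : {pred G}) := {
  gpredJr : forall x g : G, x \in S -> x ^ g \in S
}.

#[short(type="normalClosed")]
HB.structure Definition NormalClosed (G : groupType) :=
  {S of GroupClosed G S & isConjClosed G S}.

Section Subgroup.
Variables (G : groupType) (H : groupClosed G).

Definition subgroup_of : Type := {x : G | x \in H}.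

HB.instance Definition _ := SubChoice.on subgroup_of.

Fact subgroup_of_closed : group_closed (fun x : G => x \in H).
Proof. by split; [exact: gpred1 | exact: gpredF]. Qed.

HB.instance Definition _ :=
  SubChoice_isSubGroup.Build G (fun x : G => x \in H) subgroup_of
    subgroup_of_closed.

End Subgroup.

Section Quotient.
Variables (G : groupType) (H : normalClosed G).

Definition eq_coset (x y : G) : bool := x^-1 * y \in H.

Fact eq_coset_equiv : equiv_class_of eq_coset.
Proof.
rewrite /eq_coset; split=> [x|x y|y x z].
- by rewrite mulVg gpred1.
- by rewrite -[y^-1 * x]invgK gpredV invgM invgK.
- move=> xy yz; have -> : x^-1 * z = (x^-1 * y) * (y^-1 * z).
    by rewrite -mulgA mulVKg.
  exact: gpredM.
Qed.

Canonical eq_coset_equiv_rel := EquivRelPack eq_coset_equiv.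

Definition quotient_by : Type := {eq_quot eq_coset}.

HB.instance Definition _ := Choice.on quotient_by.
HB.instance Definition _ := EqQuotient.on quotient_by.

Lemma eq_cosetP (x y : G) :
  reflect (\pi_quotient_by x = \pi_quotient_by y) (x^-1 * y \in H).
Proof. by rewrite -[_ \in _]/(eq_coset x y) -eqmodE; apply: eqP. Qed.

Definition quotient_one : quotient_by := \pi_quotient_by 1.
Definition quotient_inv (u : quotient_by) : quotient_by :=
  \pi_quotient_by ((repr u)^-1).
Definition quotient_mul (u v : quotient_by) : quotient_by :=
  \pi_quotient_by (repr u * repr v).

Lemma quotient_invE (x : G) :
  quotient_inv (\pi_quotient_by x) = \pi_quotient_by (x^-1).
Proof.
rewrite /quotient_inv; case: piP => y /eq_cosetP xy; apply/esym/eq_cosetP.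
have := gpredJr _ x^-1 (gpredVr _ xy).
by rewrite /conjg !invgK invgM invgK -!mulgA mulgV mulg1.
Qed.

Lemma quotient_mulE (x y : G) :
  quotient_mul (\pi_quotient_by x) (\pi_quotient_by y) = \pi_quotient_by (x * y).
Proof.
rewrite /quotient_mul; case: piP => x' /eq_cosetP xx'.
case: piP => y' /eq_cosetP yy'; apply/esym/eq_cosetP.
have := gpredM _ _ (gpredJr _ y xx') yy'.
by rewrite /conjg invgM -!mulgA mulVKg.
Qed.

Fact quotient_mulgA : associative quotient_mul.
Proof.
elim/quotW=> x; elim/quotW=> y; elim/quotW=> z.
rewrite (quotient_mulE y z) (quotient_mulE x y).
by rewrite (quotient_mulE x) (quotient_mulE _ z) mulgA.
Qed.

Fact quotient_mul1g : left_id quotient_one quotient_mul.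
Proof. by move=> u; rewrite -[u]reprK quotient_mulE mul1g. Qed.

Fact quotient_mulg1 : right_id quotient_one quotient_mul.
Proof. by move=> u; rewrite -[u]reprK quotient_mulE mulg1. Qed.

Fact quotient_mulVg : left_inverse quotient_one quotient_inv quotient_mul.
Proof.
by move=> u; rewrite -[u]reprK quotient_invE quotient_mulE mulVg.
Qed.

Fact quotient_mulgV : right_inverse quotient_one quotient_inv quotient_mul.
Proof.
by move=> u; rewrite -[u]reprK quotient_invE quotient_mulE mulgV.
Qed.

HB.instance Definition _ := isGroup.Build quotient_by
  quotient_mulgA quotient_mul1g quotient_mulg1 quotient_mulVg quotient_mulgV.

Lemma piM (x y : G) :
  \pi_quotient_by (x * y) = \pi_quotient_by x * \pi_quotient_by y.
Proof. by rewrite -quotient_mulE. Qed.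

End Quotient.

Section Restriction.
Variables (G : groupType) (H : groupClosed G) (a : {multiplicative G -> G}).
Hypothesis aH : forall x : G, x \in H -> a x \in H.

Definition restrict_to (u : subgroup_of H) : subgroup_of H :=
  exist _ (a (val u)) (aH (valP u)).

Fact restrict_toM : {morph restrict_to : u v / u * v}.
Proof. by move=> u v; apply: val_inj; rewrite /= gmulfM. Qed.

HB.instance Definition _ := isMultiplicative.Build _ _ restrict_to restrict_toM.

End Restriction.

Section Induced.
Variables (G : groupType) (H : normalClosed G) (a : {multiplicative G -> G}).
Hypothesis aH : forall x : G, x \in H -> a x \in H.

(* [aH] makes the map independent of the choice of representatives, see       *)
(* [induced_onE].                                                             *)
Definition induced_on of (forall x : G, x \in H -> a x \in H) :
    quotient_by H -> quotient_by H :=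
  fun u => \pi_(quotient_by H) (a (repr u)).

Lemma induced_onE (x : G) :
  induced_on aH (\pi_(quotient_by H) x) = \pi_(quotient_by H) (a x).
Proof.
rewrite /induced_on; case: piP => y /eq_cosetP xy; apply/esym/eq_cosetP.
suff -> : (a x)^-1 * a y = a (x^-1 * y) by exact: aH.
by apply: (@mulgI _ (a x)); rewrite mulVKg -gmulfM mulVKg.
Qed.

Fact induced_onM : {morph induced_on aH : u v / u * v}.
Proof.
move=> u v; rewrite -[u]reprK -[v]reprK -piM !induced_onE.
by rewrite gmulfM piM.
Qed.

HB.instance Definition _ :=
  isMultiplicative.Build _ _ (induced_on aH) induced_onM.

End Induced.

Section WordLength.
Variable G : groupType.

Definition is_word (T w : seq G) : bool :=
  all (fun x => (x \in T) || (x^-1 \in T)) w.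

Definition generates (T : seq G) : Prop :=
  forall g : G, exists2 w : seq G, is_word T w & \prod_(x <- w) x = g.

Record finite_generating_set := FiniteGeneratingSet {
  generators :> seq G;
  generatorsP : generates generators
}.

Definition word_of_size (T : seq G) (g : G) (n : nat) : bool :=
  `[< exists w : seq G,
        [/\ is_word T w, \prod_(x <- w) x = g & size w = n] >].

Fact word_of_size_ex (T : finite_generating_set) (g : G) :
  exists n, word_of_size T g n.
Proof.
have [w Tw wg] := generatorsP T g.
by exists (size w); apply/asboolP; exists w.
Qed.

Definition word_length (T : finite_generating_set) (g : G) : nat :=
  ex_minn (word_of_size_ex T g).

(* The [m = 0] term of the sequence is irrelevant for the limit superior.     *)
Definition growth_rate (R : realType) (T : finite_generating_set)
    (b : {multiplicative G -> G}) : \bar R :=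
  ereal_sup (range (fun g : G =>
    limn_esup (fun m : nat =>
      (((word_length T (iter m b g))%:R : R) `^ (m%:R^-1))%R%:E))).

End WordLength.

(* Main.v *)
Require Import Defs.
From HB Require Import structures.
From mathcomp Require Import all_boot all_order all_algebra.
From mathcomp Require Import all_classical all_reals all_analysis.
From mathcomp Require Import ring lra.

Set Implicit Arguments.
Unset Strict Implicit.
Unset Printing Implicit Defensive.

Import Order.TTheory GRing.Theory Num.Theory.
Import numFieldNormedType.Exports.

(** The obstacle is that conjugating an element of H by a long word may
    lengthen it exponentially, so one should never collect the H-part of an
    iterate on one side. Instead, measure the elements of Gamma by words mixing
    two kinds of letters: lifts of the letters of Gamma / H, of weight W, and
    the letters of H, of weight 1, in any order.

    Let l < m both exceed the two growth rates. As there are finitely many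
    letters, some N works for all of them: beta = alpha^N sends a letter of H
    to a word of at most l^N letters of H, and a letter of Gamma / H to a word
    of at most l^N letters of Gamma / H. So beta sends a lift to a product of
    at most l^N lifts and an error term in H of length at most D, where D is
    fixed. Its weight is at most W l^N + D <= W m^N as soon as
    W >= D / (m^N - l^N) ([extension_weight_stretch]): with a large weight on
    lifts, the error terms are absorbed in the passage from l to m. Then beta
    multiplies weights of arbitrary words by at most m^N
    ([weighted_product_stretch]), and since weights dominate word lengths,
    |alpha^(N k) g| <= C m^(N k) ([extension_geometric_bound]). Applying this to
    alpha^r g for r < N bounds the growth rate of alpha by every real number
    above m.

    Growth rates below 1, which occur only when every orbit reaches the
    identity, go through the same argument: all inequalities are between real
    numbers, and a word length at most l^N < 1 is zero. *)

Lemma near_forall_in (X : eqType) (s : seq X) (P : X -> nat -> Prop) :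
  (forall x, x \in s -> \forall n \near \oo%classic, P x n) ->
  \forall n \near \oo%classic, forall x, x \in s -> P x n.
Proof.
elim: s => [|a s IHs] sP; first exact: nearW.
have aP := sP a (mem_head _ _).
have sP' : \forall n \near \oo%classic, forall x, x \in s -> P x n.
  by apply: IHs => x xs; apply: sP; rewrite inE xs orbT.
near=> n => x; rewrite inE => /predU1P[->|]; first by near: n.
by move: x; near: n.
Unshelve. all: by end_near. Qed.

(** * Word length *)

Section WordLengthTheory.
Local Open Scope group_scope.
Variables (G : groupType) (T : finite_generating_set G).

(** The list of admissible letters turns conditions on letters into finitely
    many conditions, to which [near_forall_in] applies. *)
Definition letters : seq G := T ++ [seq x^-1 | x <- T].

Lemma is_wordE (w : seq G) : is_word T w = all (mem letters) w.
Proof.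
apply: eq_all => x /=; rewrite mem_cat; congr (_ || _).
by rewrite -[x in RHS]invgK mem_map//; apply: invg_inj.
Qed.

Lemma word_lengthP (g : G) :
  exists w : seq G, [/\ is_word T w, \prod_(x <- w) x = g
    & size w = word_length T g].
Proof.
by rewrite /word_length; case: ex_minnP => n /asboolP[w [? ? ?]] _; exists w.
Qed.

Lemma word_length_le (w : seq G) :
  is_word T w -> (word_length T (\prod_(x <- w) x) <= size w)%N.
Proof.
move=> Tw; rewrite /word_length; case: ex_minnP => n _; apply.
by apply/asboolP; exists w.
Qed.

Lemma word_length1 : word_length T 1 = 0%N.
Proof. by apply/eqP; rewrite -leqn0 -(big_nil 1 *%g xpredT id) word_length_le. Qed.

Lemma word_lengthM (g h : G) :
  (word_length T (g * h) <= word_length T g + word_length T h)%N.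
Proof.
have [v [Tv <- <-]] := word_lengthP g; have [w [Tw <- <-]] := word_lengthP h.
by rewrite -big_cat -size_cat word_length_le// is_wordE all_cat -!is_wordE Tv.
Qed.

End WordLengthTheory.

(** * Growth rates and geometric bounds *)

Section GrowthRate.
Local Open Scope ring_scope.
Variables (R : realType) (G : groupType) (T : finite_generating_set G).
Variable b : {multiplicative G -> G}.

Lemma growth_rate_ge0 : (0 <= growth_rate R T b)%E.
Proof.
apply: le_trans (ereal_sup_ubound _); last by exists 1%g.
apply: limf_esup_ge0 => [[n _ /(_ n)]|m]; first by apply => /=.
by rewrite lee_fin powR_ge0.
Qed.

(** A bound on the limit superior of the m-th roots bounds the roots themselves
    for large m; restricting to m > 0 allows undoing the root. *)
Lemma growth_rate_lt (l : R) (g : G) : (growth_rate R T b < l%:E)%E ->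
  \forall m \near \oo%classic, (word_length T (iter m b g))%:R <= l ^+ m.
Proof.
move=> bl; have : (limn_esup (fun m : nat =>
      (((word_length T (iter m b g))%:R : R) `^ (m%:R^-1))%R%:E) < l%:E)%E.
  by apply: le_lt_trans bl; apply: ereal_sup_ubound; exists g.
move=> /ereal_inf_lt[_ [V nearV <-] Vl].
near=> m; have m0 : (0 < m)%N by near: m; exact: nbhs_infty_gt.
have : (((word_length T (iter m b g))%:R : R) `^ (m%:R^-1))%R <= l.
  rewrite -lee_fin; apply/ltW; apply: le_lt_trans Vl; apply: ereal_sup_ubound.
  by exists m => //; near: m.
move=> /(lerXn2r m); rewrite !nnegrE powR_ge0 => /(_ isT) ml.
have le0l : 0 <= l.
  rewrite -lee_fin; apply/ltW; apply: le_lt_trans Vl.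
  apply: le_trans (ereal_sup_ubound _); last first.
    by exists m => //; near: m.
  by rewrite lee_fin powR_ge0.
apply: le_trans (ml le0l).
by rewrite -powR_mulrn ?powR_ge0// -powRrM mulVf ?powRr1// pnatr_eq0 -lt0n.
Unshelve. all: by end_near. Qed.

Lemma growth_rate_le (l : R) : 0 <= l ->
  (forall g : G, \forall m \near \oo%classic,
    (word_length T (iter m b g))%:R <= l ^+ m) ->
  (growth_rate R T b <= l%:E)%E.
Proof.
move=> l0 bl; apply: ge_ereal_sup => _ [g _ <-].
pose V := [set m : nat | (word_length T (iter m b g))%:R <= l ^+ m /\ (0 < m)%N]%classic.
apply: (@le_trans _ _ (ereal_sup [set
   (((word_length T (iter m b g))%:R : R) `^ (m%:R^-1))%R%:E | m in V]%classic)).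
  apply: ereal_inf_lbound; exists V => //.
  by apply: filterI; [exact: bl|exact: nbhs_infty_gt].
apply: ge_ereal_sup => _ [m [ml m0] <-]; rewrite lee_fin.
apply: (@le_trans _ _ ((l ^+ m) `^ m%:R^-1)).
  by apply: ge0_ler_powR; rewrite ?nnegrE ?exprn_ge0// invr_ge0 ler0n.
by rewrite -powR_mulrn// -powRrM mulfV ?powRr1// pnatr_eq0 -lt0n.
Qed.

End GrowthRate.

Lemma near_geometric_le (R : realType) (C m l : R) : (0 < m)%R -> (m < l)%R ->
  \forall n \near \oo%classic, (C * m ^+ n <= l ^+ n)%R.
Proof.
move=> m0 ml; have l0 : (0 < l)%R := lt_trans m0 ml.
have q1 : (`|m / l| < 1)%R.
  by rewrite ger0_norm ?divr_ge0 ?ltW// ltr_pdivrMr// mul1r.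
have cv0 : ((C * (m / l) ^+ n)%R @[n --> \oo%classic] --> 0%R)%classic.
  by rewrite -(mulr0 C); apply: cvgM; [exact: cvg_cst|exact: cvg_expr].
apply: filterS (cvgr_le 0%R cv0 1%R ltr01) => n.
by rewrite expr_div_n mulrA ler_pdivrMr ?exprn_gt0// mul1r.
Qed.

(** * Products of weighted generators *)

Section WeightedProduct.
Variables (R : realType) (G : groupType) (wt : G -> R -> Prop).
Local Open Scope ring_scope.

(** A relation rather than a length function: [wt] may give several weights to
    one element, as happens when a lift also belongs to H, and no shortest
    expression ever has to be chosen. *)
Inductive weighted_product : G -> R -> Prop :=
| WeightedOne : weighted_product 1%g 0
| WeightedGenerator g x : wt g x -> weighted_product g x
| WeightedMul g h x y : weighted_product g x -> weighted_product h y ->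
    weighted_product (g * h)%g (x + y).

Lemma weighted_product_prod (X : Type) (f : X -> G) (c : R) (w : seq X) 
    (p : pred X) :
  (forall x, p x -> wt (f x) c) -> all p w ->
  weighted_product (\prod_(x <- w) f x)%g (c * (size w)%:R).
Proof.
move=> fc; elim: w => [|x w IHw] /=.
  by rewrite big_nil mulr0 => _; exact: WeightedOne.
move=> /andP[xp /IHw ?]; rewrite big_cons -addn1 addnC natrD mulrDr mulr1.
by apply: WeightedMul => //; apply/WeightedGenerator/fc.
Qed.

(** Both sides of the estimate are additive over products, so that it suffices
    to check generators. *)
Lemma weighted_product_stretch (b : G -> G) (L : R) :
  {morph b : g h / (g * h)%g} ->
  (forall g x, wt g x -> exists2 y, y <= L * x & weighted_product (b g) y) ->
  forall g x, weighted_product g x ->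
    exists2 y, y <= L * x & weighted_product (b g) y.
Proof.
move=> bM bwt g x; elim=> {g x} [|g x /bwt//|g h x y _ [x' xx' gx'] _ [y' yy' hy']].
- exists 0; first by rewrite mulr0.
  suff -> : b 1%g = 1%g by exact: WeightedOne.
  by apply: (@mulgI _ (b 1%g)); rewrite -bM !mulg1.
- by exists (x' + y'); [rewrite mulrDr lerD|rewrite bM; exact: WeightedMul].
Qed.

Lemma word_length_weighted_product (T : finite_generating_set G) (c : R) :
  (forall g x, wt g x -> (word_length T g)%:R <= c * x) ->
  forall g x, weighted_product g x -> (word_length T g)%:R <= c * x.
Proof.
move=> wtc g x; elim=> {g x} [|g x /wtc//|g h x y _ gx _ hy].
  by rewrite word_length1 mulr0.
rewrite mulrDr; apply: le_trans (lerD gx hy).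
by rewrite -natrD ler_nat word_lengthM.
Qed.

End WeightedProduct.

(** * Stretching words in a group extension *)

Section Extension.
Local Open Scope ring_scope.
Local Open Scope quotient_scope.
Variables (R : realType) (Gamma : groupType) (H : normalClosed Gamma).
Variables (T : finite_generating_set Gamma).
Variables (S : finite_generating_set (subgroup_of H)).
Variables (U : finite_generating_set (quotient_by H)).

Local Notation pi := (\pi_(quotient_by H)).

Lemma pi_lift (w : seq (quotient_by H)) :
  pi (\prod_(u <- w) repr u)%g = (\prod_(u <- w) u)%g.
Proof.
elim: w => [|u w IHw]; first by rewrite !big_nil.
by rewrite !big_cons piM reprK IHw.
Qed.

(** Lifting a shortest word for the image of g letter by letter recovers g up to
    an error in H. *)
Lemma lift_decomposition (g : Gamma) :
  exists w, exists h : subgroup_of H,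
    [/\ is_word U w, size w = word_length U (pi g)
      & g = ((\prod_(u <- w) repr u) * val h)%g].
Proof.
have [w [Uw wg sw]] := word_lengthP U (pi g).
have /eq_cosetP wgH : pi (\prod_(u <- w) repr u)%g = pi g by rewrite pi_lift.
exists w, (exist (fun x => x \in H) _ wgH); split=> //=.
by rewrite mulgA mulgV mul1g.
Qed.

Lemma val_prod (w : seq (subgroup_of H)) :
  val (\prod_(s <- w) s)%g = (\prod_(s <- w) val s)%g.
Proof. by elim/big_rec2: _ => // s x y _ <-. Qed.

(** In the application [b] is a power of the endomorphism: a single factor [L]
    then bounds the stretching of every letter. *)
Variables (b : Gamma -> Gamma) (L L' : R).
Hypothesis bM : {morph b : x y / (x * y)%g}.
Hypothesis L_ge0 : 0 <= L.
Hypothesis LL' : L < L'.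
Hypothesis bU : forall u, u \in letters U ->
  (word_length U (pi (b (repr u))))%:R <= L.
Hypothesis bS : forall s, s \in letters S ->
  exists2 h : subgroup_of H, val h = b (val s) & (word_length S h)%:R <= L.

Definition extension_weight (W : R) (g : Gamma) (x : R) : Prop :=
  (exists2 u, u \in letters U & g = repr u /\ x = W) \/
  (exists2 s, s \in letters S & g = val s /\ x = 1).

Lemma weighted_lift (W : R) (w : seq (quotient_by H)) : is_word U w ->
  weighted_product (extension_weight W) (\prod_(u <- w) repr u)%g
    (W * (size w)%:R).
Proof.
rewrite is_wordE; apply: weighted_product_prod => u uU.
by left; exists u.
Qed.

Lemma weighted_val (W : R) (h : subgroup_of H) :
  weighted_product (extension_weight W) (val h) (word_length S h)%:R.
Proof.
have [w [Sw <- <-]] := word_lengthP S h.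
rewrite val_prod -[X in weighted_product _ _ X]mul1r.
move: Sw; rewrite is_wordE; apply: weighted_product_prod => s sS.
by right; exists s.
Qed.

(** The error in H made when lifting the image of a letter is a fixed quantity,
    so that giving lifts a large weight W makes it at most the slack
    (L' - L) W. *)
Lemma extension_weight_stretch : exists2 W : R, 1 <= W &
  forall g x, extension_weight W g x ->
    exists2 y, y <= L' * x & weighted_product (extension_weight W) (b g) y.
Proof.
have [D Dh] : exists D : nat, forall u, u \in letters U ->
    exists w, exists h : subgroup_of H,
    [/\ is_word U w, (size w)%:R <= L, (word_length S h <= D)%N
      & b (repr u) = ((\prod_(v <- w) repr v) * val h)%g].
  apply: (@filter_ex _ \oo%classic); apply: near_forall_in => u uU.
  have [w [h [Uw sw bu]]] := lift_decomposition (b (repr u)).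
  near=> D; exists w, h; split=> //; first by rewrite sw bU.
  by near: D; exact: nbhs_infty_ge.
have dL : 0 < L' - L by rewrite subr_gt0.
(* The summand 1 serves to make weights dominate word lengths. *)
exists (D%:R / (L' - L) + 1); first by rewrite lerDr divr_ge0// ltW.
set W := _ + 1.
have DW : D%:R <= (L' - L) * W.
  by rewrite mulrDr mulr1 mulrCA mulfV ?gt_eqF// mulr1 lerDl ltW.
have W0 : 0 <= W by rewrite addr_ge0// divr_ge0// ltW.
move=> g x [[u uU [-> ->]]|[s sS [-> ->]]].
- have [w [h [Uw wL hD ->]]] := Dh u uU.
  exists (W * (size w)%:R + (word_length S h)%:R).
    have -> : L' * W = W * L + (L' - L) * W by ring.
    by rewrite lerD ?ler_wpM2l// (le_trans _ DW)// ler_nat.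
  exact: WeightedMul (weighted_lift _ Uw) (weighted_val _ _).
- have [h <- hL] := bS sS; exists (word_length S h)%:R.
    by rewrite mulr1 (le_trans hL)// ltW.
  exact: weighted_val.
Unshelve. all: by end_near. Qed.

(** Weights bound word lengths up to a constant factor, hence the word length
    inherits the geometric growth of the weight. *)
Lemma extension_geometric_bound (g : Gamma) : exists C : R, forall k,
  (word_length T (iter k b g))%:R <= C * L' ^+ k.
Proof.
have L'0 : 0 <= L' by rewrite (le_trans L_ge0)// ltW.
have [W W1 bW] := extension_weight_stretch.
have [c cU cS] : exists2 c : nat,
    forall u, u \in letters U -> (word_length T (repr u) <= c)%N &
    forall s, s \in letters S -> (word_length T (val s) <= c)%N.
  have nearU : \forall c \near \oo%classic,
      forall u, u \in letters U -> (word_length T (repr u) <= c)%N.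
    by apply: near_forall_in => u _; exact: nbhs_infty_ge.
  have nearS : \forall c \near \oo%classic,
      forall s, s \in letters S -> (word_length T (val s) <= c)%N.
    by apply: near_forall_in => s _; exact: nbhs_infty_ge.
  by have [c []] := filter_ex (filterI nearU nearS); exists c.
have lenT : forall g x, weighted_product (extension_weight W) g x ->
    (word_length T g)%:R <= c%:R * x.
  apply: word_length_weighted_product => ? ? [[u uU [-> ->]]|[s sS [-> ->]]].
    by rewrite (@le_trans _ _ c%:R) ?ler_nat ?cU// ler_peMr.
  by rewrite mulr1 ler_nat cS.
have [w [h [Uw _ gE]]] := lift_decomposition g.
have gx := WeightedMul (weighted_lift W Uw) (weighted_val W h).
rewrite -gE in gx; set x := (_ + _ : R) in gx.
exists (c%:R * x) => k.
suff [y yx /lenT ky] : exists2 y, y <= L' ^+ k * x &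
    weighted_product (extension_weight W) (iter k b g) y.
  by rewrite (le_trans ky)// -mulrA ler_wpM2l// mulrC.
elim: k => [|k [y yx ky]]; first by exists x; rewrite ?expr0 ?mul1r.
have [z zy kz] := weighted_product_stretch bM bW ky.
by exists z => //; rewrite (le_trans zy)// exprS -mulrA ler_wpM2l.
Qed.

End Extension.

Theorem theorem3p2 (R : realType) (Gamma : groupType) (H : normalClosed Gamma)
  (T : finite_generating_set Gamma)
  (S : finite_generating_set (subgroup_of H))
  (U : finite_generating_set (quotient_by H))
  (alpha : {multiplicative Gamma -> Gamma})
  (alphaH : forall x : Gamma, x \in H -> alpha x \in H) :
  (growth_rate R T alpha <=
   Order.max (growth_rate R S (restrict_to alphaH))
             (growth_rate R U (induced_on alphaH)))%E.
Proof.
set M := Order.max _ _.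
have M0 : (0 <= M)%E by rewrite le_max growth_rate_ge0.
have [->|] := eqVneq M +oo%E; first exact: leey.
rewrite -ltey => Moo; have := M0; rewrite -(@fineK _ M) ?ge0_fin_numE//.
rewrite lee_fin => M0r; apply/lee_addgt0Pr => e e0; rewrite -EFinD.
(* Two intermediate rates: the step from l to m absorbs the error terms in H,
   the step from m to M + e absorbs the multiplicative constants. *)
pose l := (fine M + e / 3)%R; pose m := (fine M + e / 3 *+ 2)%R.
have l0 : (0 < l)%R by rewrite /l; lra.
have lm : (l < m)%R by rewrite /l /m; lra.
have me : (m < fine M + e)%R by rewrite /m; lra.
have m0 : (0 < m)%R := lt_trans l0 lm.
have Ml : (M < l%:E)%E by rewrite -(@fineK _ M) ?ge0_fin_numE// lte_fin /l; lra.
have [Sl Ul] : (growth_rate R S (restrict_to alphaH) < l%:E)%E /\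
    (growth_rate R U (induced_on alphaH) < l%:E)%E.
  by move: Ml; rewrite gt_max => /andP.
apply: growth_rate_le => [|g]; first by rewrite addr_ge0// ltW.
have [N [SN [UN N0]]] : exists N : nat,
    (forall s, s \in letters S ->
       ((word_length S (iter N (restrict_to alphaH) s))%:R <= l ^+ N)%R) /\
    ((forall u, u \in letters U ->
       ((word_length U (iter N (induced_on alphaH) u))%:R <= l ^+ N)%R) /\
     (0 < N)%N).
  have nearS : \forall n \near \oo%classic, forall s, s \in letters S ->
      ((word_length S (iter n (restrict_to alphaH) s))%:R <= l ^+ n)%R.
    by apply: near_forall_in => s _; exact: growth_rate_lt.
  have nearU : \forall n \near \oo%classic, forall u, u \in letters U ->
      ((word_length U (iter n (induced_on alphaH) u))%:R <= l ^+ n)%R.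
    by apply: near_forall_in => u _; exact: growth_rate_lt.
  exact: filter_ex (filterI nearS (filterI nearU (nbhs_infty_gt 0))).
have iter_alphaM n : {morph iter n alpha : x y / (x * y)%g}.
  by elim: n => [|n IHn] x y //=; rewrite IHn gmulfM.
have iterU n x : (\pi_(quotient_by H) (iter n alpha x) =
    iter n (induced_on alphaH) (\pi_(quotient_by H) x))%qT.
  by elim: n => //= n <-; rewrite induced_onE.
have iterS n s : val (iter n (restrict_to alphaH) s) = iter n alpha (val s).
  by elim: n => //= n <-.
have bound x : exists C : R, forall k,
    ((word_length T (iter k (iter N alpha) x))%:R <= C * (m ^+ N) ^+ k)%R.
  apply: (@extension_geometric_bound _ _ _ T S U _ (l ^+ N)%R) => //.
  - by rewrite exprn_ge0// ltW.
  - by rewrite ltrXn2r ?ltW// -lt0n.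
  - by move=> u uU; rewrite iterU reprK UN.
  - by move=> s sS; exists (iter N (restrict_to alphaH) s); [rewrite iterS|exact: SN].
(* The bound is only known along multiples of N, so the constant depends on the
   residue r of n; there are finitely many residues. *)
have : \forall n \near \oo%classic, forall r, r \in iota 0 N ->
    forall k, n = (r + k * N)%N ->
    ((word_length T (iter n alpha g))%:R <= (fine M + e) ^+ n)%R.
  apply: near_forall_in => r _; have [C Ck] := bound (iter r alpha g).
  have := near_geometric_le (C / m ^+ r)%R m0 me; apply: filterS => n Cn k nE.
  apply: le_trans Cn; rewrite nE exprD mulrA divfK ?gt_eqF ?exprn_gt0//.
  by rewrite mulnC exprM (le_trans _ (Ck k))// addnC iterD mulnC iterM.
apply: filterS => n /(_ (n %% N)%N); rewrite mem_iota add0n ltn_mod N0.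
by move=> /(_ isT (n %/ N)%N); apply; rewrite addnC -divn_eq.
Qed.
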